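(* Let $Q=(q_k)_{k\ge1}$ be a sequence of integers with $q_k>1$, let $\varepsilon_k\in\{0,1,\dots,q_k-1\}$ for all $k$, and let $x=\sum_{k=1}^\infty\frac{\varepsilon_k}{q_1q_2\cdots q_k}$. For a strictly increasing sequence $(n_k)_{k\ge1}$ of positive integers define, for $k\ge1$, $$\mu_k=q_{n_k+1}q_{n_k+2}\cdots q_{n_{k+1}}-1,\qquad \lambda_k=\varepsilon_{n_k+1}q_{n_k+2}\cdots q_{n_{k+1}}+\varepsilon_{n_k+2}q_{n_k+3}\cdots q_{n_{k+1}}+\dots+\varepsilon_{n_{k+1}-1}q_{n_{k+1}}+\varepsilon_{n_{k+1}}.$$ Then $x$ is rational if and only if there exists a strictly increasing sequence $(n_k)_{k\ge1}$ of positive integers such that for all $k\ge1$ the following hold: (i) $\frac{\lambda_k}{\mu_k}$ does not depend on $k$; (ii) $\lambda_k=\frac{\mu_k}{\mu}\lambda$, where $\mu=\min_{k\in\mathbb N}\mu_k$ and $\lambda=\lambda_{k^*}$ for an index $k^*$ with $\mu_{k^*}=\mu$.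
   Context: With these notations, $x=\sum_{j=1}^{n_1}\frac{\varepsilon_j}{q_1\cdots q_j}+\frac{1}{q_1\cdots q_{n_1}}\sum_{k=1}^\infty\frac{\lambda_k}{(\mu_1+1)\cdots(\mu_k+1)}$. *)

(* Defs.v *)
From HB Require Import structures.
From mathcomp Require Import all_boot all_order all_algebra.
From mathcomp Require Import all_classical all_reals all_analysis.

Set Implicit Arguments.
Unset Strict Implicit.
Unset Printing Implicit Defensive.

Import Order.TTheory GRing.Theory Num.Theory.
Import numFieldNormedType.Exports.

(* Sequences indexed by k >= 1 are functions on nat whose value at 0 is
   irrelevant: every hypothesis is restricted to positive indices and the
   formulas below only use positive indices. *)

Definition cantor_base (q : nat -> nat) : Prop :=
  forall k, (0 < k)%N -> (1 < q k)%N.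

Definition cantor_digits (q eps : nat -> nat) : Prop :=
  forall k, (0 < k)%N -> (eps k < q k)%N.

Definition cantor_psum (R : realType) (q eps : nat -> nat) (m : nat) : R :=
  (\sum_(1 <= k < m.+1) (eps k)%:R / (\prod_(1 <= j < k.+1) q j)%N%:R)%R.

Definition strictly_increasing_pos (n : nat -> nat) : Prop :=
  (forall k, (0 < k)%N -> (0 < n k)%N) /\
  (forall k l, (0 < k)%N -> (k < l)%N -> (n k < n l)%N).

(* The truncated subtraction is exact as soon as cantor_base q holds, since
   the product is then positive. *)
Definition mu (q n : nat -> nat) (k : nat) : nat :=
  (\prod_((n k).+1 <= j < (n k.+1).+1) q j - 1)%N.

Definition lambda (q eps n : nat -> nat) (k : nat) : nat :=
  (\sum_((n k).+1 <= i < (n k.+1).+1)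
     eps i * \prod_(i.+1 <= j < (n k.+1).+1) q j)%N.

(* Main.v *)
(* Write P_m = q_1 ... q_m, S_m for the m-th partial sum, and T_m = P_m (x - S_m),
   which lies in [0, 1]; then T_a P_b / P_a = lambda + T_b for the block digit
   lambda between a and b.  If x = u / v then v T_m is an integer in [0, v], so
   T takes some value t infinitely often; along those indices
   t (mu_k + 1) = lambda_k + t, i.e. lambda_k / mu_k = t.  Conversely, if
   lambda_k = c mu_k for all k then S_{n_k} + c / P_{n_k} is independent of k,
   and its limit is x, so x = S_{n_1} + c / P_{n_1} with c rational. *)
Require Import Defs.
From HB Require Import structures.
From mathcomp Require Import all_boot all_order all_algebra.
From mathcomp Require Import all_classical all_reals all_analysis.
From mathcomp Require Import ring.

Import Order.TTheory GRing.Theory Num.Theory.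
Import numFieldNormedType.Exports.
Local Open Scope classical_set_scope.
Local Open Scope ring_scope.

(** * Products of bases and block digits between two cut points *)

Definition base_prod (q : nat -> nat) (a b : nat) : nat :=
  \prod_(a.+1 <= j < b.+1) q j.

(** The integer with mixed-radix digits [eps a.+1, ..., eps b], hence the numerator of [S b - S a]
    over [P b]. At consecutive cut points it is convertible to [lambda]. *)
Definition block_digit (q eps : nat -> nat) (a b : nat) : nat :=
  \sum_(a.+1 <= i < b.+1) eps i * \prod_(i.+1 <= j < b.+1) q j.

Lemma base_prodxx q a : base_prod q a a = 1%N.
Proof. by rewrite /base_prod big_geq. Qed.

Lemma base_prodS q a b : (a <= b)%N ->
  base_prod q a b.+1 = (base_prod q a b * q b.+1)%N.
Proof. by move=> ab; rewrite /base_prod big_nat_recr. Qed.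

Lemma base_prod_cat q a b c : (a <= b)%N -> (b <= c)%N ->
  base_prod q a c = (base_prod q a b * base_prod q b c)%N.
Proof. by move=> ab bc; rewrite /base_prod (@big_cat_nat _ _ _ b.+1). Qed.

Lemma block_digitxx q eps a : block_digit q eps a a = 0%N.
Proof. by rewrite /block_digit big_geq. Qed.

Lemma block_digitS q eps a b : (a <= b)%N ->
  block_digit q eps a b.+1 = (block_digit q eps a b * q b.+1 + eps b.+1)%N.
Proof.
move=> ab; rewrite /block_digit big_nat_recr //=.
rewrite [X in (_ + eps _ * X)%N]big_geq // muln1 big_distrl /=; congr (_ + _)%N.
apply: eq_big_nat => i /andP[_ ib].
by rewrite big_nat_recr //= mulnA.
Qed.

Lemma base_prod_gt0 q a b : cantor_base q -> (0 < base_prod q a b)%N.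
Proof.
move=> hq; rewrite /base_prod big_nat_cond; apply: prodn_cond_gt0 => i.
by move=> /andP[/andP[ai _] _]; apply: ltnW; apply: hq; apply: leq_trans ai.
Qed.

Lemma ltn_base_prod q m : cantor_base q -> (m < base_prod q 0 m)%N.
Proof.
move=> hq; elim: m => [|m IHm]; first by rewrite base_prodxx.
rewrite base_prodS //; apply: leq_ltn_trans IHm _.
by rewrite ltn_Pmulr ?base_prod_gt0 // hq.
Qed.

Lemma base_prod_gt1 q a b : cantor_base q -> (a < b)%N -> (1 < base_prod q a b)%N.
Proof.
case: b => // b hq ab; rewrite base_prodS //.
apply: leq_trans (hq b.+1 _) _ => //.
by rewrite leq_pmull // base_prod_gt0.
Qed.

(** * Pigeonhole, subsequences, minima and an Archimedean criterion *)

Lemma infinite_pigeonhole (b : nat) (f : nat -> nat) :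
  (forall m, f m <= b)%N ->
  exists t, forall N, exists2 m, (N < m)%N & f m = t.
Proof.
move=> fb; apply: contrapT => /forallNP nt.
have {}nt t : exists N, forall m, (N < m)%N -> f m <> t.
  have /existsNP[N hN] := nt t; exists N => m Nm fm.
  by apply: hN; exists m.
have [B hB] := choice nt.
(* If each value t stopped occurring after [B t], then at [M], beyond [B t] for every t <= b, no
   value would be left for [f]. *)
pose M := (\max_(t < b.+1) B t).+1.
apply: (hB (f M) M) => //.
by rewrite ltnS (leq_bigmax (Ordinal (fb M : (f M < b.+1)%N))).
Qed.

Lemma infinitely_often_subseq (P : nat -> Prop) :
  (forall N, exists2 m, (N < m)%N & P m) ->
  exists n, strictly_increasing_pos n /\ forall k, (0 < k)%N -> P (n k).
Proof.
move=> hP.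
have /choice[next nextP] : forall N, exists m, (N < m)%N /\ P m.
  by move=> N; have [m] := hP N; exists m.
(* The start 0 need not satisfy [P]: only positive indices count, and each of those is an output of
   [next]. *)
exists (fun k => iter k next 0%N); split; last by case=> // k _; exact: (nextP _).2.
split; first by case=> // k _ /=; apply: leq_ltn_trans (nextP _).1.
by move=> k l _; apply: (homo_ltn ltn_trans) => i /=; exact: (nextP _).1.
Qed.

Lemma exists_argmin (f : nat -> nat) :
  exists2 k, (0 < k)%N & forall l, (0 < l)%N -> (f k <= f l)%N.
Proof.
have h : exists v, `[< exists2 k, (0 < k)%N & f k = v >].
  by exists (f 1%N); apply/asboolP; exists 1%N.
case: (ex_minnP h) => v /asboolP[k k0 <-] hmin.
by exists k => // l l0; apply: hmin; apply/asboolP; exists l.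
Qed.

Lemma eq0_norm_le_inv (R : realType) (y C : R) :
  (forall k : nat, (0 < k)%N -> `|y| <= C / k%:R) -> y = 0.
Proof.
move=> hy; apply/eqP; rewrite -normr_le0; apply/ler_addgt0Pl => e e0.
(* This k exceeds C / e, so C / k <= e. *)
rewrite addr0; pose k := (Num.truncn (C / e)).+1.
apply: le_trans (hy k _) _ => //.
rewrite ler_pdivrMr ?ltr0n // -ler_pdivrMl // mulrC.
exact/ltW/truncnS_gt.
Qed.

(** * Partial sums and tails of the Cantor series *)

Section CantorSeries.
Context {R : realType} (q eps : nat -> nat) (x : R).
Hypotheses (hq : cantor_base q) (heps : cantor_digits q eps).
Hypothesis hx : cantor_psum R q eps @ \oo --> x.

Local Notation P := (base_prod q 0).
Local Notation S := (cantor_psum R q eps).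

Let P_gt0 m : 0 < (P m)%:R :> R.
Proof. by rewrite ltr0n base_prod_gt0. Qed.

Lemma cantor_psumS m : S m.+1 = S m + (eps m.+1)%:R / (P m.+1)%:R.
Proof. by rewrite /cantor_psum big_nat_recr. Qed.

Lemma cantor_psum_block a b : (a <= b)%N ->
  S b = S a + (block_digit q eps a b)%:R / (P b)%:R.
Proof.
move=> /subnK <-; elim: (b - a)%N => [|d IHd].
  by rewrite block_digitxx mul0r addr0.
rewrite addSn cantor_psumS IHd block_digitS ?leq_addl // base_prodS //.
have := P_gt0 (d + a); have : 0 < (q (d + a).+1)%:R :> R.
  by rewrite ltr0n ltnW ?hq.
rewrite natrD !natrM => /lt0r_neq0 ? /lt0r_neq0 ?; field.
by apply/andP; split.
Qed.

Lemma cantor_psum_le a b : (a <= b)%N -> S a <= S b.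
Proof.
by move=> /cantor_psum_block ->; rewrite lerDl divr_ge0.
Qed.

(** Since a digit is at most q - 1, one step adds at most (q_{m+1} - 1) / P_{m+1} = 1/P_m -
    1/P_{m+1}. With [cantor_psum_le] this makes the intervals [S_m, S_m + 1/P_m] nested, which traps
    x. *)
Lemma cantor_psum_inv_le a b : (a <= b)%N ->
  S b + (P b)%:R^-1 <= S a + (P a)%:R^-1.
Proof.
move=> /subnK <-; elim: (b - a)%N => [|d /(le_trans _)]//; apply.
rewrite addSn cantor_psumS base_prodS // -addrA lerD2l.
have q0 : 0 < (q (d + a).+1)%:R :> R by rewrite ltr0n ltnW ?hq.
rewrite -[X in _ + X]mul1r -mulrDl natrM ler_pdivrMr ?mulr_gt0 //.
rewrite mulrA mulVf ?gt_eqF // mul1r natr1 ler_nat.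
exact: heps.
Qed.

Lemma cantor_tail_ge0 m : 0 <= x - S m.
Proof.
rewrite subr_ge0 -(cvg_lim _ hx) //; apply: limr_ge.
  by apply/cvg_ex; exists x.
by exists m => // j /=; apply: cantor_psum_le.
Qed.

Lemma cantor_tail_le m : x - S m <= (P m)%:R^-1.
Proof.
rewrite lerBlDl -(cvg_lim _ hx) //; apply: limr_le.
  by apply/cvg_ex; exists x.
exists m => // j /= /cantor_psum_inv_le; apply: le_trans.
by rewrite lerDl invr_ge0.
Qed.

Definition scaled_tail m := (P m)%:R * (x - S m).

Lemma scaled_tail_block a b : (a <= b)%N ->
  (base_prod q a b)%:R * scaled_tail a
    = (block_digit q eps a b)%:R + scaled_tail b.
Proof.
move=> ab; rewrite /scaled_tail (cantor_psum_block _ _ ab).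
have /lt0r_neq0 := P_gt0 b; rewrite (base_prod_cat q 0 a b) // natrM.
by rewrite mulf_eq0 negb_or => /andP[? ?]; field; apply/andP.
Qed.

Lemma scaled_tail_rational (a : int) (b : nat) : (0 < b)%N ->
  x = a%:~R / b%:R ->
  forall m, exists2 d : nat, (d <= b)%N & scaled_tail m = d%:R / b%:R.
Proof.
move=> b0 xab m; have b0' : 0 < b%:R :> R by rewrite ltr0n.
(* [z] is b T_m: P_m x has denominator b, and P_m S_m is the integer [block_digit q eps 0 m]. *)
pose z : int := (P m)%:Z * a - b%:Z * (block_digit q eps 0 m)%:Z.
have zE : z%:~R = b%:R * scaled_tail m.
  rewrite /scaled_tail xab (cantor_psum_block 0 m) // /cantor_psum big_geq //.
  rewrite rmorphB !rmorphM /= -!pmulrn.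
  have /lt0r_neq0 P0 := P_gt0 m; field.
  by rewrite P0 gt_eqF.
have z0 : 0 <= z.
  by rewrite -(ler0z R) zE !mulr_ge0 ?cantor_tail_ge0.
have zb : z <= b%:Z.
  rewrite -(ler_int R) zE -pmulrn -[leRHS]mulr1 ler_pM2l // /scaled_tail.
  by rewrite mulrC -ler_pdivlMr // mul1r cantor_tail_le.
case: z zE z0 zb => // d zE _ zb; exists d => //.
by rewrite -[d%:R]/(d%:~R) zE mulrC mulKf ?gt_eqF.
Qed.

Lemma mu_natr (n : nat -> nat) k :
  (mu q n k)%:R = (base_prod q (n k) (n k.+1))%:R - 1 :> R.
Proof. by rewrite /mu natrB // base_prod_gt0. Qed.

Lemma mu_gt0 n k : strictly_increasing_pos n -> (0 < k)%N -> (0 < mu q n k)%N.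
Proof. by move=> [_ nS] k0; rewrite /mu subn_gt0 base_prod_gt1 // nS. Qed.

(** * The two directions of the equivalence *)

Lemma rational_lambda : rational x ->
  exists n (t : R), strictly_increasing_pos n /\
    forall k, (0 < k)%N -> (lambda q eps n k)%:R = t * (mu q n k)%:R.
Proof.
move=> /rationalP[a [b xab]].
(* The denominator given by [rationalP] may be 0, in which case the quotient is 0 and is rewritten
   as 0 / 1. *)
have {a b xab}[a [b b0 xab]] : exists a : int,
    exists2 b : nat, (0 < b)%N & x = a%:~R / b%:R.
  case: b xab => [xa|b xab]; last by exists a, b.+1.
  by exists 0, 1%N; rewrite // xa invr0 mulr0 mul0r.
have /choice[d hd] : forall m, exists d : nat,
    (d <= b)%N /\ scaled_tail m = d%:R / b%:R.
  by move=> m; have [d] := scaled_tail_rational a b b0 xab m; exists d.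
have [t /infinitely_often_subseq[n [n_incr nt]]] :=
  infinite_pigeonhole b d (fun m => (hd m).1).
exists n, (t%:R / b%:R); split=> // k k0.
have tailE l : (0 < l)%N -> scaled_tail (n l) = t%:R / b%:R.
  by move=> l0; rewrite (hd _).2 nt.
have := scaled_tail_block (n k) (n k.+1) (ltnW (n_incr.2 _ _ k0 (ltnSn k))).
rewrite !tailE // mu_natr -[lambda _ _ _ _]/(block_digit q eps (n k) (n k.+1)).
by move=> e; rewrite mulrBr mulr1 [_ * _%:R]mulrC e addrK.
Qed.

Lemma lambda_rational n (c : R) : strictly_increasing_pos n ->
  (forall k, (0 < k)%N -> (lambda q eps n k)%:R = c * (mu q n k)%:R) ->
  x = S (n 1%N) + c / (P (n 1%N))%:R.
Proof.
move=> [n_pos n_incr] hc.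
have le_n k : (k <= n k)%N.
  elim: k => // -[_|k IHk]; first exact: n_pos.
  exact: leq_ltn_trans IHk (n_incr _ _ _ _).
(* Telescoping: c / P_{n_k} - c / P_{n_{k+1}} = c mu_k / P_{n_{k+1}} = lambda_k / P_{n_{k+1}},
   exactly the increment of S over the block. *)
have const k : S (n k.+1) + c / (P (n k.+1))%:R = S (n 1%N) + c / (P (n 1%N))%:R.
  elim: k => // k <-.
  have nk : (n k.+1 <= n k.+2)%N by apply/ltnW/n_incr.
  rewrite (cantor_psum_block _ _ nk).
  rewrite -[block_digit _ _ _ _]/(lambda q eps n k.+1) hc // mu_natr.
  have /lt0r_neq0 := P_gt0 (n k.+2); rewrite (base_prod_cat q 0 (n k.+1)) //.
  by rewrite natrM mulf_eq0 negb_or => /andP[? ?]; field; apply/andP.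
(* The distance from x to the constant is at most (1 + |c|) / P_{n_k}, by the tail bound, and
   P_{n_k} > n_k >= k. *)
apply/subr0_eq/(@eq0_norm_le_inv _ _ (1 + `|c|)) => -[//|k] _.
rewrite -(const k) opprD addrA; apply: le_trans (ler_normB _ _) _.
rewrite mulrDl mul1r normrM normfV normr_nat (ger0_norm (cantor_tail_ge0 _)).
have le_inv : (P (n k.+1))%:R^-1 <= k.+1%:R^-1 :> R.
  rewrite lef_pV2 ?posrE ?ltr0n ?base_prod_gt0 // ler_nat.
  exact: leq_trans (le_n _) (ltnW (ltn_base_prod _ _ hq)).
by apply: lerD; [exact: le_trans (cantor_tail_le _) le_inv | exact: ler_wpM2l].
Qed.

Lemma rational_cantor_psum m : rational (S m).
Proof.
apply/rationalP; exists (block_digit q eps 0 m)%:Z, (P m).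
by rewrite (cantor_psum_block 0 m) // /cantor_psum big_geq // add0r -pmulrn.
Qed.

End CantorSeries.

Theorem theorem4 (R : realType) (q eps : nat -> nat) (x : R)
    (hq : cantor_base q) (heps : cantor_digits q eps)
    (hx : cantor_psum R q eps @ \oo --> x) :
  rational x <->
  exists n : nat -> nat,
    [/\ strictly_increasing_pos n,
        forall k l : nat, (0 < k)%N -> (0 < l)%N ->
          (lambda q eps n k)%:R / (mu q n k)%:R
            = (lambda q eps n l)%:R / (mu q n l)%:R :> R
      & exists kstar : nat,
          [/\ (0 < kstar)%N,
              forall k : nat, (0 < k)%N -> (mu q n kstar <= mu q n k)%N
            & forall k : nat, (0 < k)%N ->
                (lambda q eps n k)%:R
                  = (mu q n k)%:R / (mu q n kstar)%:R
                      * (lambda q eps n kstar)%:R :> R]].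

Proof.
split.
  move=> /(rational_lambda _ _ _ hq heps hx)[n [t [n_incr ht]]].
  have mu0 k : (0 < k)%N -> (mu q n k)%:R != 0 :> R.
    by move=> k0; rewrite pnatr_eq0 -lt0n mu_gt0.
  have [kstar k0 kmin] := exists_argmin (mu q n).
  exists n; split => //.
    by move=> k l k1 l1; rewrite !ht // !mulfK ?mu0.
  exists kstar; split=> // k k1; rewrite !ht //.
  by rewrite [t * _]mulrC -mulrA [t * _]mulrC mulKf ?mu0.
move=> [n [n_incr hc _]].
pose c : R := (lambda q eps n 1)%:R / (mu q n 1)%:R.
have hlam k : (0 < k)%N -> (lambda q eps n k)%:R = c * (mu q n k)%:R.
  by move=> k0; rewrite /c -(hc k) // divfK // pnatr_eq0 -lt0n mu_gt0.
rewrite (lambda_rational _ _ _ hq heps hx n c n_incr hlam).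
have [r _ <-] := rational_cantor_psum (R := R) q eps hq (n 1%N).
(* The same closed formula evaluated in [rat], with [r] a preimage of S_{n_1}; the morphism [ratr]
   carries it to the real value. *)
exists (r + (lambda q eps n 1)%:R / (mu q n 1)%:R / (base_prod q 0 (n 1))%:R) => //.
by rewrite rmorphD /= !fmorph_div /= !ratr_nat.
Qed.
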